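(* For every integer $d\ge 1$ and every integer $r\ge 2$ there exists a positive integer $t$ with the following property. Whenever $C\subset\mathbb{R}^d$ is a set of $(d+1)t$ points partitioned into $t$-point subsets $C_1,\ldots,C_{d+1}$, there exist pairwise disjoint sets $R_1,\ldots,R_r\subseteq C$, each of which is rainbow (i.e., $|R_i\cap C_j|\le 1$ for all $i\in[r]$, $j\in[d+1]$), such that $\bigcap_{i=1}^r\operatorname{conv}(R_i)\neq\emptyset$.
   Context: $[k]=\{1,\ldots,k\}$. The sets $C_1,\ldots,C_{d+1}$ are thought of as color classes. The sets $R_i$ are not required to cover $C$. *)

(* Defs.v *)
From Stdlib Require Import Reals.
From mathcomp Require Import all_boot.
Set Implicit Arguments. Unset Strict Implicit. Unset Printing Implicit Defensive.

Definition point (d : nat) := 'I_d -> R.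

Definition in_conv (d : nat) (I : finType) (p : I -> point d) (S : {set I})
    (x : point d) : Prop :=
  exists w : I -> R,
    (forall i, Rle R0 (w i)) /\
    (forall i, i \notin S -> w i = R0) /\
    \big[Rplus/R0]_(i : I) w i = R1 /\
    (forall c : 'I_d, x c = \big[Rplus/R0]_(i : I) Rmult (w i) (p i c)).

(* Index set of C: a point is indexed by (color j, position k), j < d+1, k < t. *)
Definition rainbow (n t : nat) (S : {set 'I_n * 'I_t}) : Prop :=
  forall j : 'I_n, #|[set k : 'I_t | (j, k) \in S]| <= 1.

(* Main.v *)
(* A geometric version of the Blagojevic-Matschke-Ziegler degree argument. Let q + 1 be an
   odd prime with q >= r and take color classes of size q. Sarkaria's tensor trick sends a
   point x with label j to (x, 1) (x) w_j, where w_0, ..., w_q are the vertices of a simplex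
   in dimension q centered at the origin; labelings s of the points that are injective on
   every color class then give N = (d+1) q vectors in dimension N, and it suffices to find
   such a labeling whose vectors, together with one auxiliary vector y, have the origin in
   their convex hull: the first q label classes share a point of their convex hulls.
   The number of such labelings, counted with orientation signs, is a degree. Moving the
   points one at a time to the configuration where color class i is the i-th unit vector
   changes it only by simplices swept over the origin, which come in free orbits of
   the cyclic group of order q + 1; and for that configuration it equals (q!)^(d+1),
   which is not divisible by q + 1. *)
Require Import Defs.
From Stdlib Require Import Reals.
From mathcomp Require Import all_boot all_order all_algebra perm.
From mathcomp Require Import ring lra zify Rstruct.
Set Implicit Arguments. Unset Strict Implicit. Unset Printing Implicit Defensive.
Import Order.TTheory GRing.Theory Num.Theory.
Local Open Scope ring_scope.

(** * Strict linear inequalities over an ordered field: perturbation and Gordan's alternative *)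

Section Position.
Variable F : realFieldType.

Lemma small_step_pos n (hs : seq 'cV[F]_n) (p w : 'rV[F]_n) :
  (forall h, h \in hs -> 0 < (p *m h) 0 0) ->
  exists2 t : F, 0 < t & forall e h, 0 < e -> e <= t -> h \in hs ->
    0 < ((p + e *: w) *m h) 0 0.
Proof.
elim: hs => [|h hs IH] pos; first by exists 1.
have [|t t0 Ht] := IH; first by move=> k kh; apply: pos; rewrite inE kh orbT.
have ph := pos h (mem_head _ _).
set a := (p *m h) 0 0 in ph; set c := (w *m h) 0 0.
have d0 : 0 < `|c| + 1 by rewrite ltr_wpDl.
exists (Num.min t (a / 2 / (`|c| + 1))).
  by rewrite lt_min t0 /= !divr_gt0.
move=> e k e0; rewrite le_min => /andP[et ea]; rewrite inE => /predU1P[->|kh]; last exact: Ht.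
have -> : ((p + e *: w) *m h) 0 0 = a + e * c by rewrite mulmxDl -scalemxAl mxE [X in _ + X]mxE.
have : e * (`|c| + 1) <= a / 2 by rewrite -ler_pdivlMr.
have : - (e * c) <= e * `|c| by rewrite -mulrN ler_pM2l // -normrN ler_norm.
lra.
Qed.

Lemma sqr_row_gt0 n (k : 'cV[F]_n) : k != 0 -> 0 < (k^T *m k) 0 0.
Proof.
move=> /eqP k0; rewrite lt_def mxE; apply/andP; split; last first.
  by apply: sumr_ge0 => i _; rewrite mxE -expr2 sqr_ge0.
apply/negP => /eqP /psumr_eq0P H; apply: k0; apply/matrixP=> i j.
have := H (fun i _ => _) i isT; rewrite ord1 !mxE => E.
by apply/eqP; rewrite -[_ == 0]sqrf_eq0 expr2 E // => l; rewrite mxE -expr2 sqr_ge0.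
Qed.

(** If [p] vanishes on [k], a small step along [k^T] repairs it; the sign obtained there joins the
    strict constraints, so that later steps cannot undo it. *)
Lemma perturb_avoid n (ks hs : seq 'cV[F]_n) (p : 'rV[F]_n) :
  (forall h, h \in hs -> 0 < (p *m h) 0 0) ->
  (forall k, k \in ks -> k != 0) ->
  exists2 p' : 'rV[F]_n, forall h, h \in hs -> 0 < (p' *m h) 0 0 &
    forall k, k \in ks -> (p' *m k) 0 0 != 0.
Proof.
elim: ks hs p => [|k ks IH] hs p pos nz; first by exists p.
have [p1 pos1 p1k] : exists2 p1 : 'rV[F]_n,
    forall h, h \in hs -> 0 < (p1 *m h) 0 0 & (p1 *m k) 0 0 != 0.
  have [pk|pk] := eqVneq ((p *m k) 0 0) 0; last by exists p.
  have [t t0 Ht] := small_step_pos k^T pos.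
  exists (p + t *: k^T) => [h hh|]; first exact: Ht.
  rewrite mulmxDl -scalemxAl mxE pk [X in _ + X]mxE add0r.
  by rewrite mulf_neq0 ?gt_eqF ?sqr_row_gt0 ?nz ?mem_head.
pose k' := Num.sg ((p1 *m k) 0 0) *: k.
have k'E p' : (p' *m k') 0 0 = Num.sg ((p1 *m k) 0 0) * (p' *m k) 0 0.
  by rewrite -scalemxAr mxE.
have [|l lk|p' pos' av] := IH (k' :: hs) p1.
- by move=> h; rewrite inE => /predU1P[->|/pos1//]; rewrite k'E -normrEsg normr_gt0.
- by apply: nz; rewrite inE lk orbT.
exists p' => [h hh|l]; first by apply: pos'; rewrite inE hh orbT.
rewrite inE => /predU1P[->|/av//]; have := pos' k' (mem_head _ _).
by rewrite k'E; apply: contraTneq => ->; rewrite mulr0 ltxx.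
Qed.

(** Gordan's alternative, by induction on the number of vectors. *)
Lemma gordan n (s : seq 'rV[F]_n) :
  (exists h : 'cV[F]_n, forall v, v \in s -> 0 < (v *m h) 0 0) \/
  (exists c : 'I_(size s) -> F, [/\ forall i, 0 <= c i, exists i, 0 < c i &
     \sum_i c i *: s`_i = 0]).
Proof.
have [k] := ubnP (size s); elim: k s => // k IH [|v s] sk.
  by left; exists 0.
have [[h hp]|[c [c0 [i ci] cs]]] := IH s sk; last first.
  right; exists (fun j => if unlift 0 j is Some j' then c j' else 0); split.
  - by move=> j; case: unliftP.
  - by exists (lift 0 i); rewrite liftK.
  rewrite big_ord_recl unlift_none scale0r add0r -[RHS]cs.
  by apply: eq_bigr => j _; rewrite liftK.
have [v0|v0] := eqVneq v 0.
  right; exists (fun j => (j == 0)%:R); split.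
  - by move=> j; rewrite ler0n.
  - by exists 0; rewrite eqxx ltr01.
  rewrite big_ord_recl v0 scaler0 add0r big1 // => j _.
  by rewrite (_ : _%:R = 0 :> F) ?scale0r.
set a := - (v *m h) 0 0.
have [a0|a0] := ltP a 0.
  left; exists h => w; rewrite inE => /predU1P[->|/hp//].
  by move: a0; rewrite oppr_lt0.
(* [f w] is a nonnegative combination of [w] and [v] on which [h] vanishes, so a nonnegative
   dependence of the [f w] unfolds into one of [v :: s]. *)
pose f w := a *: w + (w *m h) 0 0 *: v.
have fE h' w : (f w *m h') 0 0 = a * (w *m h') 0 0 + (w *m h) 0 0 * (v *m h') 0 0.
  by rewrite mulmxDl -!scalemxAl mxE [X in X + _]mxE [X in _ + X]mxE.
have [|[h' hp']|[c [c0 [i ci] cs]]] := IH [seq f w | w <- s]; first by rewrite size_map.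
  (* [h''] vanishes on [v] and is positive on [s]; adding a small multiple of [v^T] makes it positive on [v]. *)
  pose h'' := (v *m h') 0 0 *: h + a *: h'.
  have h''E w : (w *m h'') 0 0 = (v *m h') 0 0 * (w *m h) 0 0 + a * (w *m h') 0 0.
    by rewrite mulmxDr -!scalemxAr mxE [X in X + _]mxE [X in _ + X]mxE.
  have [|t t0 Ht] := @small_step_pos _ [seq w^T | w <- s] h''^T v.
    move=> _ /mapP[w ws ->]; rewrite -trmx_mul mxE h''E addrC mulrC.
    have := hp' (f w) (map_f _ ws); rewrite fE; lra.
  left; exists (h'' + t *: v^T) => w; rewrite inE => /predU1P[->|ws].
    have vv : 0 < (v *m v^T) 0 0.
      by rewrite -{1}[v]trmxK sqr_row_gt0 // -trmx0 (inj_eq (@trmx_inj _ _ _)).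
    rewrite mulmxDr -scalemxAr mxE [X in _ + X]mxE h''E.
    have := mulr_gt0 t0 vv; rewrite /a; lra.
  have := Ht t w^T t0 (lexx _) (map_f _ ws).
  have -> : h''^T + t *: v = (h'' + t *: v^T)^T by apply/matrixP=> x y; rewrite !mxE.
  by rewrite -trmx_mul mxE.
right.
have sz : size [seq f w | w <- s] = size s by rewrite size_map.
pose c' j := c (cast_ord (esym sz) j).
have cs' : \sum_j c' j *: f s`_j = 0.
  rewrite -[RHS]cs (reindex (cast_ord sz)) /=; last first.
    by exists (cast_ord (esym sz)) => j _; rewrite ?cast_ordK ?cast_ordKV.
  apply: eq_bigr => j _; rewrite /c' cast_ordK; congr (_ *: _).
  by rewrite (nth_map 0) //= -sz.
exists (fun j => if unlift 0 j is Some j' then a * c' j'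
   else \sum_j' c' j' * (s`_j' *m h) 0 0); split.
- move=> j; case: unliftP => [j' _|_]; first by rewrite mulr_ge0 ?c0.
  by apply: sumr_ge0 => j' _; rewrite mulr_ge0 ?c0 ?ltW ?hp ?mem_nth.
- exists 0; rewrite unlift_none (bigD1 (cast_ord sz i)) //=.
  rewrite ltr_pwDl //.
    by apply: mulr_gt0; [rewrite /c' cast_ordK|rewrite hp // mem_nth // -sz].
  by apply: sumr_ge0 => j' _; rewrite mulr_ge0 ?c0 ?ltW ?hp ?mem_nth.
rewrite big_ord_recl unlift_none -[RHS]cs' scaler_suml -big_split /=.
apply: eq_bigr => j _; rewrite liftK /f scalerDr !scalerA addrC.
by rewrite [c' j * a]mulrC.
Qed.

End Position.

(** * Signed minors, the three-term Pluecker relation and orientation signs of simplices *)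

Section Chirotope.
Variable F : realFieldType.

(* Up to sign, the minor of [M] without row [i] (resp. without rows [i] and [j]):
   bordering by unit columns takes care of all the signs. *)
Definition bdet1 n (M : 'M[F]_(n.+1, n)) (i : 'I_n.+1) : F :=
  \det (row_mx (delta_mx i 0 : 'cV[F]_n.+1) M : 'M[F]_(1 + n)).

Definition bdet2 n (M : 'M[F]_(n.+2, n)) (i j : 'I_n.+2) : F :=
  \det (row_mx (delta_mx i 0 : 'cV[F]_n.+2)
         (row_mx (delta_mx j 0 : 'cV[F]_n.+2) M) : 'M[F]_(1 + (1 + n))).

Lemma det_row_mx_col n (x : 'cV[F]_n.+1) (M : 'M[F]_(n.+1, n)) :
  \det (row_mx x M : 'M[F]_(1 + n)) =
  \sum_i x i 0 * ((-1) ^+ i * \det (row' i M)).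
Proof.
pose z : 'I_(1 + n) := lshift n 0.
rewrite (expand_det_col _ z); apply: eq_bigr => i _.
rewrite row_mxEl /cofactor addn0; congr (_ * (_ * \det _)).
apply/matrixP=> a b; rewrite !mxE.
have -> : lift z b = rshift 1 b by apply: val_inj.
by rewrite (unsplitK (inr _)).
Qed.

Lemma bdet1E n (M : 'M[F]_(n.+1, n)) (i : 'I_n.+1) :
  bdet1 M i = (-1) ^+ i * \det (row' i M).
Proof.
rewrite /bdet1 det_row_mx_col (bigD1 i) //= big1 ?addr0 => [|k ki].
  by rewrite mxE !eqxx mul1r.
by rewrite mxE (negbTE ki) mul0r.
Qed.

(** Cramer's rule: coordinate [c] is the expansion along the first column of a determinant in which
    column [c] of [M] occurs twice. *)
Lemma bdet1_dependence n (M : 'M[F]_(n.+1, n)) : \sum_k bdet1 M k *: row k M = 0.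
Proof.
apply/matrixP=> a c; rewrite summxE mxE.
transitivity (\det (row_mx (col c M) M : 'M[F]_(1 + n))).
  rewrite det_row_mx_col; apply: eq_bigr => k _.
  by rewrite bdet1E !mxE mulrC.
rewrite -det_tr; apply: (@determinant_alternate _ _ _ (lshift _ 0) (rshift 1 c)) => // k.
by rewrite !mxE (unsplitK (inl _)) (unsplitK (inr _)) !mxE.
Qed.

Lemma bdet1_mulmx n (M : 'M[F]_(n.+1, n)) G k : bdet1 (M *m G) k = bdet1 M k * \det G.
Proof.
rewrite !bdet1E -mulrA -det_mulmx; congr (_ * \det _).
by apply/matrixP=> a b; rewrite !mxE; apply: eq_bigr => c _; rewrite !mxE.
Qed.

Definition cons_row m n (y : 'rV[F]_n) (M : 'M[F]_(m, n)) : 'M[F]_(m.+1, n) :=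
  \matrix_(i, c) if unlift 0 i is Some l then M l c else y 0 c.

Lemma cons_row0 m n (y : 'rV[F]_n) (M : 'M[F]_(m, n)) c : cons_row y M 0 c = y 0 c.
Proof. by rewrite mxE unlift_none. Qed.

Lemma cons_rowS m n (y : 'rV[F]_n) (M : 'M[F]_(m, n)) l c :
  cons_row y M (lift 0 l) c = M l c.
Proof. by rewrite mxE liftK. Qed.

Lemma row'0_cons_row m n (y : 'rV[F]_n) (M : 'M[F]_(m, n)) : row' 0 (cons_row y M) = M.
Proof. by apply/matrixP=> i c; rewrite mxE cons_rowS. Qed.

Lemma row'1_cons_row m n (y x : 'rV[F]_n) (M : 'M[F]_(m, n)) :
  row' (lift 0 0) (cons_row y (cons_row x M)) = cons_row y M.
Proof.
apply/matrixP=> i c; rewrite mxE; have [l ->|->] := unliftP 0 i.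
  by rewrite cons_rowS (_ : lift _ _ = lift 0 (lift 0 l)) ?cons_rowS //; apply: val_inj.
by rewrite cons_row0 (_ : lift _ _ = 0) ?cons_row0 //; apply: val_inj.
Qed.

Lemma row_cons_row0 m n (y : 'rV[F]_n) (M : 'M[F]_(m, n)) : row 0 (cons_row y M) = y.
Proof. by apply/rowP=> c; rewrite mxE cons_row0. Qed.

Lemma row_cons_rowS m n (y : 'rV[F]_n) (M : 'M[F]_(m, n)) l :
  row (lift 0 l) (cons_row y M) = row l M.
Proof. by apply/rowP=> c; rewrite mxE cons_rowS mxE. Qed.

Lemma cons_row_mulmx m n k (y : 'rV[F]_n) (M : 'M[F]_(m, n)) (G : 'M[F]_(n, k)) :
  cons_row y M *m G = cons_row (y *m G) (M *m G).
Proof.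
apply/matrixP=> i c; have [l ->|->] := unliftP 0 i.
  by rewrite cons_rowS !mxE; apply: eq_bigr => a _; rewrite cons_rowS.
by rewrite cons_row0 !mxE; apply: eq_bigr => a _; rewrite cons_row0.
Qed.

Lemma row'_eq m n (M M' : 'M[F]_(m, n)) i :
  (forall k, k != i -> row k M = row k M') -> row' i M = row' i M'.
Proof.
move=> E; apply/matrixP=> a c; have := E (lift i a); rewrite eq_sym neq_lift => /(_ isT).
by move=> /rowP/(_ c); rewrite !mxE.
Qed.

Lemma bdet1_cons_row n (y : 'rV[F]_n) (M : 'M[F]_n) : bdet1 (cons_row y M) 0 = \det M.
Proof. by rewrite bdet1E mul1r row'0_cons_row. Qed.

Lemma det2 (A : 'M[F]_2) : \det A = A 0 0 * A 1 1 - A 1 0 * A 0 1.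
Proof.
have l0 : lift (0 : 'I_2) (0 : 'I_1) = 1 by apply: val_inj.
have l1 : lift (1 : 'I_2) (0 : 'I_1) = 0 by apply: val_inj.
rewrite (expand_det_row _ 0) !big_ord_recl big_ord0 /cofactor !det_mx11 !mxE.
rewrite !l0 !l1 /= expr0 expr1; ring.
Qed.

Lemma det_lblock_id n (Y : 'M[F]_(2 + n)) :
  (forall a b, Y a (rshift 2 b) = (a == rshift 2 b)%:R) ->
  \det Y = Y (lshift n 0) (lshift n 0) * Y (lshift n 1) (lshift n 1)
         - Y (lshift n 1) (lshift n 0) * Y (lshift n 0) (lshift n 1).
Proof.
move=> YE.
have Yur : ursubmx Y = 0.
  by apply/matrixP=> a b; rewrite !mxE YE eq_lrshift.
have Ydr : drsubmx Y = 1%:M.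
  by apply/matrixP=> a b; rewrite !mxE YE (inj_eq (@rshift_inj _ _)).
transitivity (\det (block_mx (ulsubmx Y) 0 (dlsubmx Y) 1%:M)).
  by rewrite -Yur -Ydr submxK.
by rewrite det_lblock det1 mulr1 det2 !mxE.
Qed.

Lemma bdet2_lift n (M : 'M[F]_(n.+2, n)) i k :
  bdet2 M i (lift i k) = (-1) ^+ i * bdet1 (row' i M) k.
Proof.
rewrite /bdet2 -/(bdet1 _ i) bdet1E /bdet1.
congr (_ * \det _); apply/matrixP=> a b; rewrite !mxE.
case: splitP => c _; rewrite !mxE // (inj_eq (@lift_inj _ i)).
by [].
Qed.

(** Three-term Grassmann-Pluecker relation. The inverse of the matrix bordered at [i], [j] turns
    every [bdet2 M z t] into a constant times a 2 by 2 minor of the same two rows. *)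
Lemma bdet2_plucker n (M : 'M[F]_(n.+2, n)) i j k l : bdet2 M i j != 0 ->
  bdet2 M i j * bdet2 M k l = bdet2 M i k * bdet2 M j l - bdet2 M i l * bdet2 M j k.
Proof.
move=> nz.
set A : 'M_(1 + (1 + n)) := row_mx (delta_mx i 0 : 'cV[F]_n.+2)
         (row_mx (delta_mx j 0 : 'cV[F]_n.+2) M).
have uA : A \in unitmx by rewrite unitmxE unitfE.
set P := invmx A.
have PA : P *m A = 1%:M by rewrite mulVmx.
set A0 : 'I_(1 + (1 + n)) := lshift _ 0; set A1 : 'I_(1 + (1 + n)) := rshift 1 (lshift _ 0).
have Ez z t : bdet2 M z t = \det A * (P A0 z * P A1 t - P A1 z * P A0 t).
  rewrite /bdet2.
  set X : 'M_(1 + (1 + n)) := row_mx _ (row_mx _ M).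
  have -> : X = A *m (P *m X) by rewrite mulmxA mulmxV // mul1mx.
  rewrite det_mulmx; congr (_ * _).
  set Y := P *m X.
    have YE a (b : 'I_n) : Y a (rshift 1 (rshift 1 b)) = (a == rshift 1 (rshift 1 b))%:R.
    have <- : (1%:M : 'M[F]_(1 + (1 + n))) a (rshift 1 (rshift 1 b)) = (a == rshift 1 (rshift 1 b))%:R.
      by rewrite mxE.
    rewrite -PA /Y !mxE; apply: eq_bigr => c _; congr (_ * _).
    by rewrite /X /A !row_mxEr.
  rewrite (@det_lblock_id n Y); last first.
    move=> a b; have -> : rshift 2 b = rshift 1 (rshift 1 b) :> 'I_(1 + (1 + n)) by apply: val_inj.
    exact: YE.
  have Y0 a : Y a A0 = P a z.
    rewrite /Y /X mxE (bigD1 z) //= big1 ?addr0 => [|c cz].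
      by rewrite row_mxEl !mxE !eqxx mulr1.
    by rewrite row_mxEl !mxE (negbTE cz) mulr0.
  have Y1 a : Y a A1 = P a t.
    rewrite /Y /X mxE (bigD1 t) //= big1 ?addr0 => [|c cz].
      by rewrite row_mxEr row_mxEl !mxE !eqxx mulr1.
    by rewrite row_mxEr row_mxEl !mxE (negbTE cz) mulr0.
  have -> : lshift n (0 : 'I_2) = A0 by apply: val_inj.
  have -> : lshift n (1 : 'I_2) = A1 by apply: val_inj.
  by rewrite !Y0 !Y1.
rewrite !Ez; ring.
Qed.


Lemma bdet2_anti n (M : 'M[F]_(n.+2, n)) i j : bdet2 M i j = - bdet2 M j i.
Proof.
rewrite /bdet2 -[LHS]det_tr -[in RHS]det_tr.
set A := trmx _; set B := trmx _.
have -> : A = xrow (lshift _ 0) (rshift 1 (lshift _ 0)) B.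
  apply/matrixP=> a b; rewrite !mxE.
  case: (fintype.splitP a) => a' aE.
    have -> : a = lshift _ 0 by apply: ord_inj; rewrite /= aE ord1.
    by rewrite tpermL (unsplitK (inr _)) !mxE (unsplitK (inl _)) !mxE ord1.
  rewrite mxE; case: splitP => a'' a'E.
    have -> : a = rshift 1 (lshift _ 0) by apply: ord_inj; rewrite /= aE a'E ord1.
    by rewrite tpermR (unsplitK (inl _)) !mxE ord1.
  have -> : a = rshift 1 (rshift 1 a'') by apply: ord_inj; rewrite /= aE a'E.
  by rewrite tpermD // (unsplitK (inr _)) mxE (unsplitK (inr _)).
by rewrite xrowE det_mulmx det_perm odd_tperm mulN1r.
Qed.

Definition all_sign (T : finType) (e : T -> F) : int :=
  [forall k, 0 < e k]%:R - [forall k, e k < 0]%:R.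

(** With [0 < e i j] read as an arrow from [i] to [j], a sink is a source of the transpose. *)
Definition source (T : finType) (e : T -> T -> F) i := [forall j, (j != i) ==> (0 < e i j)].

(* Seen from a source [i], the other indices are linearly ordered by the slope
   [e j k / e i k], and the index of largest slope is a sink. *)
Lemma source_sink (T : finType) (e : T -> T -> F) i :
  (forall i j, e i j = - e j i) -> (forall i j, i != j -> e i j != 0) ->
  (forall i j k l, i != j -> e i j * e k l = e i k * e j l - e i l * e j k) ->
  source e i -> exists l, source (fun a b => e b a) l.
Proof.
move=> anti nz pl /forallP src.
have [j ij|none] := pickP (fun j => j != i); last first.
  by exists i; apply/forallP => j; rewrite none.
case: (@arg_maxP _ _ _ j (fun k => k != i) (fun k => e j k / e i k) ij) => l li lmax.
exists l; apply/forallP => k; apply/implyP => kl.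
have [->|ki] := eqVneq k i; first exact: (implyP (src l)).
have eil := implyP (src l) li; have eik := implyP (src k) ki; have eij := implyP (src j) ij.
have := lmax k ki; rewrite /= ler_pdivrMr // mulrAC ler_pdivlMr // => le.
have := pl i j k l; rewrite eq_sym => /(_ ij) E.
have : 0 <= e i j * e k l by rewrite E; move: le; lra.
by rewrite pmulr_rge0 // le_eqVlt eq_sym (negbTE (nz _ _ kl)).
Qed.

Lemma source_uniq (T : finType) (e : T -> T -> F) i j :
  (forall i j, e i j = - e j i) -> source e i -> source e j -> i = j.
Proof.
move=> anti /forallP si /forallP sj; apply/eqP; apply: contraT => ij.
have := implyP (sj i) ij; rewrite anti oppr_gt0.
by move: ij; rewrite eq_sym => /(implyP (si j)) /ltW /le_gtF ->.
Qed.

Lemma sum_source (T : finType) (e : T -> T -> F) i :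
  (forall i j, e i j = - e j i) -> source e i ->
  \sum_j (source e j)%:R = 1 :> int.
Proof.
move=> anti si; rewrite (bigD1 i) //= si big1 ?addr0 // => j ji.
case: (boolP (source e j)) => // /(source_uniq anti si) ij; by rewrite ij eqxx in ji.
Qed.

(** Sources and sinks are unique, and by [source_sink] and its transpose one exists if and only if
    the other does: the sum is 1 - 1 or 0 - 0. *)
Lemma sum_source_sink (T : finType) (e : T -> T -> F) :
  (forall i j, e i j = - e j i) -> (forall i j, i != j -> e i j != 0) ->
  (forall i j k l, i != j -> e i j * e k l = e i k * e j l - e i l * e j k) ->
  \sum_i ((source e i)%:R - (source (fun a b => e b a) i)%:R) = 0 :> int.
Proof.
move=> anti nz pl; pose e' a b := e b a.
have anti' i j : e' i j = - e' j i by apply: anti.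
have nz' i j : i != j -> e' i j != 0 by rewrite eq_sym; apply: nz.
have pl' i j k l : i != j -> e' i j * e' k l = e' i k * e' j l - e' i l * e' j k.
  move=> ij; rewrite /e' [e j i]anti [e l k]anti mulrNN (pl i j k l) //.
  by rewrite [e k i]anti [e l j]anti [e l i]anti [e k j]anti !mulrNN.
rewrite sumrB; have [i si|none] := pickP (source e).
  have [l sl] := source_sink anti nz pl si.
  by rewrite (sum_source anti si) (sum_source anti' sl) subrr.
have [i si|none'] := pickP (source e').
  have [l sl] := source_sink anti' nz' pl' si.
  by have := none l; rewrite (_ : source e l).
by rewrite !big1 ?subrr // => i _; rewrite ?none //; rewrite -/e' none'.
Qed.

(* The signed indicator of the origin lying inside the simplex spanned by the rows:
   the [bdet1 M k] are the coefficients of the linear dependence of the rows. *)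
Definition simplex_sign n (M : 'M[F]_(n.+1, n)) : int := all_sign (bdet1 M).

(* The simplex sign of [M] without row [i], with its sign in the boundary formula. *)
Definition face_sign n (M : 'M[F]_(n.+2, n)) i : int :=
  (source (bdet2 M) i)%:R - (source (fun a b => bdet2 M b a) i)%:R.

Lemma all_signM (T : finType) (e : T -> F) (c : F) : 0 < c ->
  all_sign (fun k => e k * c) = all_sign e.
Proof.
move=> c0; congr (_%:R - _%:R); congr nat_of_bool; apply: eq_forallb => k.
  by rewrite pmulr_lgt0.
by rewrite pmulr_llt0.
Qed.

Lemma eq_all_sign (T : finType) (e e' : T -> F) : e =1 e' -> all_sign e = all_sign e'.
Proof.
by move=> ee; congr (_%:R - _%:R); congr nat_of_bool; apply: eq_forallb => k; rewrite ee.
Qed.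

Lemma all_signN (T : finType) (e : T -> F) : all_sign (fun k => - e k) = - all_sign e.
Proof.
rewrite /all_sign opprB; congr (_%:R - _%:R); congr nat_of_bool; apply: eq_forallb => k.
  by rewrite oppr_gt0.
by rewrite oppr_lt0.
Qed.

Lemma simplex_sign_mulmx n (M : 'M[F]_(n.+1, n)) G : 0 < \det G ->
  simplex_sign (M *m G) = simplex_sign M.
Proof. by move=> G0; rewrite -[RHS](all_signM _ G0); apply: eq_all_sign => k; rewrite bdet1_mulmx. Qed.

Lemma simplex_sign_eq0 n (M : 'M[F]_(n.+1, n)) (h : 'cV[F]_n) :
  (forall k, 0 < (row k M *m h) 0 0) -> simplex_sign M = 0.
Proof.
move=> hp; have : \sum_k bdet1 M k * (row k M *m h) 0 0 = 0.
  have := congr1 (fun x => (x *m h) 0 0) (bdet1_dependence M).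
  rewrite /= mul0mx mulmx_suml summxE => E; apply: etrans (etrans E (mxE _ _ _ _)).
  by apply: eq_bigr => k _; rewrite -scalemxAl [RHS]mxE.
move=> E; rewrite /simplex_sign /all_sign.
have -> : [forall k, 0 < bdet1 M k] = false.
  apply/negP => /forallP H; move: E => /eqP; rewrite gt_eqF // big_ord_recl.
  rewrite ltr_pwDl ?mulr_gt0 //; apply: sumr_ge0 => k _.
  by rewrite ltW // mulr_gt0.
have -> // : [forall k, bdet1 M k < 0] = false.
apply/negP => /forallP H; move: E => /eqP; rewrite -oppr_eq0 -sumrN gt_eqF // big_ord_recl.
rewrite -mulNr ltr_pwDl ?mulr_gt0 ?oppr_gt0 //; apply: sumr_ge0 => k _.
by rewrite -mulNr ltW // mulr_gt0 // oppr_gt0.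
Qed.

(** The coefficients [bdet1 (row' i M)] times [(-1) ^+ i] are the [bdet2 M i j] with [j != i]: all
    positive at a source, all negative at a sink. *)
Lemma face_signE n (M : 'M[F]_(n.+2, n)) i :
  face_sign M i = (-1) ^+ i * simplex_sign (row' i M).
Proof.
have -> : (-1) ^+ i * simplex_sign (row' i M) = all_sign (fun k => bdet2 M i (lift i k)).
  rewrite /simplex_sign -signr_odd.
  transitivity (all_sign (fun k => (-1) ^+ odd i * bdet1 (row' i M) k)).
    case: (odd i); last by rewrite expr0 mul1r; apply: eq_all_sign => k; rewrite mul1r.
    by rewrite expr1 mulN1r -all_signN; apply: eq_all_sign => k; rewrite mulN1r.
  by apply: eq_all_sign => k; rewrite bdet2_lift signr_odd.
rewrite /face_sign /all_sign; congr (_%:R - _%:R); congr nat_of_bool.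
  apply/forallP/forallP => [H k|H j].
    by apply: (implyP (H _)); rewrite eq_sym neq_lift.
  by apply/implyP; rewrite eq_sym => /unlift_some[k -> _].
apply/forallP/forallP => [H k|H j].
  by rewrite bdet2_anti oppr_lt0; apply: (implyP (H _)); rewrite eq_sym neq_lift.
by apply/implyP; rewrite eq_sym => /unlift_some[k -> _]; rewrite bdet2_anti oppr_gt0.
Qed.

Lemma bdet2_row_perm n (M : 'M[F]_(n.+2, n)) (s : 'S_n.+2) i j :
  bdet2 (row_perm s M) i j = (-1) ^+ s * bdet2 M (s i) (s j).
Proof.
rewrite /bdet2 -det_perm -det_mulmx -row_permE; congr (\det _).
apply/matrixP=> a b; rewrite !mxE; case: splitP => c _; rewrite !mxE ?(inj_eq perm_inj) //.
by case: splitP => e _; rewrite !mxE ?(inj_eq perm_inj).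
Qed.

Lemma face_sign_xrow n (M : 'M[F]_(n.+2, n)) a b i : a != b ->
  face_sign (xrow a b M) i = - face_sign M (tperm a b i).
Proof.
move=> ab; rewrite /face_sign opprB; congr (_%:R - _%:R); congr nat_of_bool;
  apply/forallP/forallP => H j; apply/implyP => ji.
- have := implyP (H (tperm a b j)); rewrite bdet2_row_perm odd_tperm ab expr1 mulN1r.
  rewrite tpermK -bdet2_anti; apply.
  by apply: contra ji => /eqP <-; rewrite tpermK.
- rewrite bdet2_row_perm odd_tperm ab expr1 mulN1r -bdet2_anti; apply: (implyP (H _)).
  by rewrite (inj_eq perm_inj).
- have := implyP (H (tperm a b j)); rewrite bdet2_row_perm odd_tperm ab expr1 mulN1r.
  rewrite tpermK -bdet2_anti; apply.
  by apply: contra ji => /eqP <-; rewrite tpermK.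
rewrite bdet2_row_perm odd_tperm ab expr1 mulN1r -bdet2_anti; apply: (implyP (H _)).
by rewrite (inj_eq perm_inj).
Qed.

(** Any [n] of the [n.+2] rows are linearly independent; equivalently, [bdet2 M] is nonzero off the
    diagonal. *)
Definition general_position n (M : 'M[F]_(n.+2, n)) :=
  forall (i j : 'I_n.+2) (c : 'rV[F]_n.+2),
    i != j -> c 0 i = 0 -> c 0 j = 0 -> c *m M = 0 -> c = 0.

(** The boundary of a simplex of dimension [n.+1], mapped linearly to [n]-space, covers the origin
    with total degree zero. *)
Lemma sum_face_sign n (M : 'M[F]_(n.+2, n)) : general_position M ->
  \sum_i face_sign M i = 0.
Proof.
move=> gp.
have nz i j : i != j -> bdet2 M i j != 0.
  move=> ij; apply/negP => /det0P[c c0 cM]; case/negP: c0; apply/eqP.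
  move: cM; rewrite !mul_mx_row => /eqP; rewrite !row_mx_eq0 => /and3P[ci cj /eqP].
  have cE k : c *m (delta_mx k 0 : 'cV_n.+2) == 0 -> c 0 k = 0.
    move=> /eqP/matrixP/(_ 0 0); rewrite !mxE (bigD1 k) //= big1 ?addr0 => [|l lk].
      by rewrite mxE !eqxx mulr1.
    by rewrite mxE (negbTE lk) mulr0.
  exact: gp ij (cE _ ci) (cE _ cj).
apply: sum_source_sink => // [i j|i j k l ij]; first exact: bdet2_anti.
exact: bdet2_plucker (nz _ _ ij).
Qed.

End Chirotope.

(** * Generic vectors and their existence *)

Section Genericity.
Variables (F : realFieldType) (n : nat) (p : nat) (G : 'M[F]_n).

(** No [x *m G ^+ j] lies in the span of fewer than [n] vectors of [L]; the functional [k] witnesses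
    this. *)
Definition generic (x : 'rV[F]_n) (L : seq 'rV[F]_n) :=
  forall (j : 'I_p) (s : seq 'rV[F]_n), {subset s <= L} -> (size s < n)%N ->
  exists2 k : 'cV[F]_n, forall v, v \in s -> v *m k = 0 & (x *m G ^+ j *m k) 0 0 != 0.

(** A nonzero coefficient at [k0] would put [x *m G ^+ j] in the span of the other rows that occur;
    as [k0], [i1] and [i2] are excluded, these are at most [m - 3 < n] rows. *)
Lemma generic_coef0 m (M : 'M[F]_(m, n)) (c : 'rV[F]_m) x L j k0 i1 i2 :
  (m <= n.+2)%N -> generic x L -> row k0 M = x *m G ^+ (j : 'I_p) ->
  (forall k, k != k0 -> c 0 k != 0 -> row k M \in L) ->
  i1 != i2 -> c 0 i1 = 0 -> c 0 i2 = 0 -> c *m M = 0 -> c 0 k0 = 0.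
Proof.
move=> mn gen Mk0 ML i12 ci1 ci2 cM; apply/eqP; apply: contraT => ck0.
pose A := [set k | (k != k0) && (c 0 k != 0)].
have [||k sk xk] := gen j [seq row k M | k <- enum A].
- by move=> v /mapP[k]; rewrite mem_enum inE => /andP[kk ck] ->; apply: ML.
- rewrite size_map -cardE.
  have sub : A \subset ~: [set k0; i1; i2].
    apply/subsetP => k; rewrite !inE => /andP[kk ck].
    by rewrite !negb_or kk /=; apply/andP; split; apply: contraNneq ck => ->; rewrite ?ci1 ?ci2.
  have : (#|[set k0; i1; i2]| = 3)%N.
    have k1 : k0 != i1 by apply: contraNneq ck0 => ->; rewrite ci1.
    have k2 : k0 != i2 by apply: contraNneq ck0 => ->; rewrite ci2.
    rewrite -setUA cardsU1 cards2 !inE i12 negb_or k1 k2 //.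
  have := subset_leq_card sub; have := cardsC [set k0; i1; i2]; rewrite card_ord; lia.
have : \sum_l c 0 l * (row l M *m k) 0 0 = 0.
  transitivity ((c *m M *m k) 0 0); last by rewrite cM mul0mx mxE.
  rewrite [c *m M]mulmx_sum_row mulmx_suml summxE; apply: eq_bigr => l _.
  by rewrite -scalemxAl [RHS]mxE.
rewrite (bigD1 k0) //= big1 ?addr0 => [|l lk0].
  by move=> /eqP; rewrite mulf_eq0 (negbTE ck0) Mk0 (negbTE xk).
have [->|cl] := eqVneq (c 0 l) 0; first by rewrite mul0r.
by rewrite sk ?mxE ?mulr0 //; apply: map_f; rewrite mem_enum inE lk0.
Qed.

Lemma annihilator (s : seq 'rV[F]_n) : (size s < n)%N ->
  exists2 k : 'cV[F]_n, k != 0 & forall v, v \in s -> v *m k = 0.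
Proof.
move=> sn; pose A := \matrix_(i < size s) s`_i.
have : cokermx A != 0.
  rewrite -mxrank_eq0 mxrank_coker subn_eq0 -ltnNge.
  exact: leq_ltn_trans (rank_leq_row _) sn.
case/matrix0Pn => i [j Aij]; exists (col j (cokermx A)).
  by apply/matrix0Pn; exists i, 0; rewrite mxE.
move=> v vs; have iv : (index v s < size s)%N by rewrite index_mem.
have -> : v = row (Ordinal iv) A by rewrite rowK nth_index.
by rewrite colE mulmxA -row_mul mulmx_coker linear0 mul0mx.
Qed.

Lemma annihilators (SS : seq (seq 'rV[F]_n)) :
  (forall s, s \in SS -> (size s < n)%N) ->
  exists2 ks : seq 'cV[F]_n, forall k, k \in ks -> k != 0 &
    forall s, s \in SS -> exists2 k, k \in ks & forall v, v \in s -> v *m k = 0.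
Proof.
elim: SS => [|s SS IH] sz; first by exists [::].
have [s' s'S|ks nz H] := IH; first by apply: sz; rewrite inE s'S orbT.
have [k k0 kv] := annihilator (sz s (mem_head _ _)).
exists (k :: ks) => [k'|s']; rewrite inE => /predU1P[->//|]; first exact: nz.
  by exists k; rewrite ?mem_head.
by move=> /H[k' k'ks H']; exists k'; rewrite ?inE ?k'ks ?orbT.
Qed.

Fixpoint words (T : Type) (L : seq T) k : seq (seq T) :=
  if k is k'.+1 then [seq x :: s | x <- L, s <- words L k'] else [:: [::]].

Lemma mem_words (T : eqType) (L s : seq T) : {subset s <= L} -> s \in words L (size s).
Proof.
elim: s => //= x s IH sL; apply/allpairsP; exists (x, s); split=> //=.
  by apply: sL; rewrite mem_head.
by apply: IH => z zs; apply: sL; rewrite inE zs orbT.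
Qed.

Lemma size_words (T : eqType) (L s : seq T) k : s \in words L k -> size s = k.
Proof. by elim: k s => [|k IH] s /=; [rewrite inE => /eqP->|move=> /allpairsP[[x t] [_ /IH <- ->]]]. Qed.

Hypothesis unitG : G \in unitmx.

Lemma exists_generic (L : seq 'rV[F]_n) (hs : seq 'cV[F]_n) (x : 'rV[F]_n) :
  (forall h, h \in hs -> 0 < (x *m h) 0 0) ->
  exists2 x', forall h, h \in hs -> 0 < (x' *m h) 0 0 & generic x' L.
Proof.
(* It suffices to avoid finitely many functionals: one annihilator for each list of fewer than [n]
   vectors of [L], pulled back by each power of [G]. *)
move=> pos; pose SS := flatten [seq words L k | k <- iota 0 n].
have [s|ks nz H] := @annihilators SS.
  by move=> /flatten_mapP[k]; rewrite mem_iota => /andP[_ kn] /size_words ->.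
pose ks' := [seq G ^+ (j : 'I_p) *m k | j <- enum 'I_p, k <- ks].
have [k|x' pos' av] := @perturb_avoid _ _ ks' hs x pos.
  move=> /allpairsP[[j k'] [_ /nz k0 ->]] /=; apply: contra k0 => /eqP E.
  have uG : G ^+ j \in unitmx.
    by elim: (j : nat) => [|i IH]; rewrite ?expr0 ?unitmx1 // exprS unitmx_mul unitG.
  by apply/eqP; apply: (can_inj (mulKmx uG)); rewrite E mulmx0.
exists x' => // j s sL sn.
have [|k kks kv] := H s.
  by apply/flatten_mapP; exists (size s); rewrite ?mem_iota // mem_words.
exists k => //; rewrite -mulmxA; apply: av.
by apply/allpairsP; exists (j, k); rewrite mem_enum.
Qed.

Definition earlier (a : 'I_n -> 'rV[F]_n) (t : nat) : seq 'rV[F]_n :=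
  [seq a l *m G ^+ (j : 'I_p) | l <- enum [pred l : 'I_n | l < t]%N, j <- enum 'I_p].

Lemma exists_generic_family (L : seq 'rV[F]_n) (hs : 'I_n -> seq 'cV[F]_n) (a : 'I_n -> 'rV[F]_n) :
  (forall l h, h \in hs l -> 0 < (a l *m h) 0 0) ->
  exists2 a' : 'I_n -> 'rV[F]_n, forall l h, h \in hs l -> 0 < (a' l *m h) 0 0 &
    forall t, generic (a' t) (L ++ earlier a' t).
Proof.
move=> pos.
suff /(_ n)[a' pos' gen'] : forall k, exists2 a' : 'I_n -> 'rV[F]_n,
    forall l h, h \in hs l -> 0 < (a' l *m h) 0 0 &
    forall t : 'I_n, (t < k)%N -> generic (a' t) (L ++ earlier a' t).
  by exists a' => // t; apply: gen'.
elim=> [|k [a' pos' gen']]; first by exists a.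
have [kn|kn] := ltnP k n; last first.
  by exists a' => // t _; apply: gen'; apply: leq_trans (ltn_ord t) kn.
have [x xpos xgen] := exists_generic (L ++ earlier a' k) (pos' (Ordinal kn)).
pose a'' l := if l == Ordinal kn then x else a' l.
have eqe t : (t <= k)%N -> earlier a'' t = earlier a' t.
  move=> tk; congr flatten; apply/eq_in_map => l; rewrite mem_enum inE => lt.
  rewrite /a'' ifN //; apply/eqP => lE.
  by move: lt; rewrite lE /= ltnNge tk.
exists a'' => [l h|t tk]; first by rewrite /a''; case: eqP => [->|_]; [apply: xpos|apply: pos'].
rewrite eqe // /a''; case: eqP => [->//|/eqP tne]; apply: gen'.
by rewrite ltn_neqAle -ltnS tk andbT; apply: contra tne => /eqP E; apply/eqP/val_inj.
Qed.

End Genericity.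

(** * The equivariant degree and its invariance modulo [p] *)

Section Degree.
Variables (F : realFieldType) (n q : nat).
Local Notation p := q.+1.
Variable (G : 'M[int]_n).
Hypothesis detG : \det G = 1.
Hypothesis sumG : \sum_(j < p) G ^+ j = 0.
Variable b : 'I_n -> 'rV[int]_n.

Local Notation GF := (map_mx intr G : 'M[F]_n).

Lemma expGp : G ^+ p = 1.
Proof.
have := subrX1 G p; rewrite sumG mulr0 => /eqP.
by rewrite subr_eq0 => /eqP.
Qed.

Lemma map_expG k : map_mx intr (G ^+ k) = GF ^+ k.
Proof.
elim: k => [|k IH]; first by rewrite !expr0 map_mx1.
by rewrite !exprS map_mxM IH.
Qed.

Lemma det_expG k : \det (G ^+ k) = 1.
Proof. by elim: k => [|k IH]; rewrite ?expr0 ?det1 // exprS det_mulmx detG IH. Qed.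

Definition config (K : comNzRingType) (H : 'M[K]_n) (a : 'I_n -> 'rV[K]_n)
    (s : {ffun 'I_n -> 'I_p}) : 'M[K]_n := \matrix_l (a l *m H ^+ s l).

(* Vanishes unless [s] is injective on color classes; it orients the join of chessboard
   complexes, whose boundary cancels because the vectors [b l *m G ^+ j] sum to zero over [j]. *)
Definition weight (s : {ffun 'I_n -> 'I_p}) : int := \det (config G b s).

Definition set_at (s : {ffun 'I_n -> 'I_p}) l j := [ffun l' => if l' == l then j else s l'].

Definition shift (k : 'I_p) (s : {ffun 'I_n -> 'I_p}) := [ffun l => (s l + k)%R].

Lemma weight_set_at s l : \sum_j weight (set_at s l j) = 0.
Proof.
have cof j c : cofactor (config G b (set_at s l j)) l c = cofactor (config G b s) l c.
  congr (_ * \det _); apply/matrixP=> i d; rewrite !mxE; apply: eq_bigr => e _.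
  by rewrite ffunE eq_sym (negbTE (neq_lift _ _)).
rewrite /weight; under eq_bigr => j _ do rewrite (expand_det_row _ l).
rewrite exchange_big big1 //= => c _.
under eq_bigr => j _ do rewrite cof.
rewrite -mulr_suml [X in X * _](_ : _ = 0) ?mul0r //.
transitivity ((b l *m \sum_(j < p) G ^+ j) 0 c); last by rewrite sumG mulmx0 mxE.
rewrite mulmx_sumr summxE; apply: eq_bigr => j _.
by rewrite mxE ffunE eqxx.
Qed.

(** Cycle property of [weight]: a factor that ignores the label of [l] comes out of the sum over
    this label, which vanishes. *)
Lemma sum_weight_indep (K : {ffun 'I_n -> 'I_p} -> int) l :
  (forall s j, K (set_at s l j) = K s) -> \sum_s weight s * K s = 0.
Proof.
move=> KE; rewrite (partition_big (fun s => set_at s l 0) predT) //= big1 // => s0 _.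
have [s0l|s0l] := eqVneq (s0 l) 0; last first.
  apply: big1 => s /eqP E; by rewrite -E ffunE !eqxx in s0l.
rewrite (reindex_onto (fun j => set_at s0 l j) (fun s => s l)) /=; last first.
  move=> s /eqP <-; apply/ffunP => l'; rewrite !ffunE; case: eqP => // -> //.
under eq_bigr => j _ do rewrite KE.
rewrite -mulr_suml [X in X * _](_ : _ = 0) ?mul0r //.
rewrite -[RHS](weight_set_at s0 l); apply: eq_bigl => j.
rewrite ffunE !eqxx andbT; apply/eqP/ffunP => l'; rewrite !ffunE.
by case: eqP => // ->.
Qed.

(** Shifts permute the labelings and move the label of [l] cyclically, so the [p] classes given by
    that label have equal sums. *)
Lemma dvd_sum_shift (T : {ffun 'I_n -> 'I_p} -> int) (l : 'I_n) :
  (forall s k, T (shift k s) = T s) -> (p%:Z %| (\sum_s T s)%R)%Z.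
Proof.
move=> TE; rewrite (partition_big (fun s : {ffun 'I_n -> 'I_p} => s l) predT) //=.
have E k : \sum_(s : {ffun 'I_n -> 'I_p} | s l == k) T s
    = \sum_(s : {ffun 'I_n -> 'I_p} | s l == 0) T s.
  rewrite (reindex (shift k)) /=; last first.
    by exists (shift (- k)) => s _; apply/ffunP => l'; rewrite !ffunE ?addrK ?subrK.
  apply: eq_big => [s|s _]; last exact: TE.
  by rewrite ffunE -subr_eq0 addrK.
under eq_bigr => k _ do rewrite E.
by rewrite sumr_const card_ord -mulr_natl natz dvdz_mulr.
Qed.

Lemma config_shift (K : comNzRingType) (H : 'M[K]_n) a s k : H ^+ p = 1 ->
  config H a (shift k s) = config H a s *m H ^+ k.
Proof.
move=> Hp; apply/row_matrixP => l; rewrite row_mul !rowK ffunE -mulmxA; congr (_ *m _).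
have -> : H ^+ s l *m H ^+ k = H ^+ (s l + k)%N by rewrite exprD.
rewrite [in RHS](divn_eq (s l + k) p) exprD [(_ * p)%N]mulnC exprM Hp expr1n mul1r.
by [].
Qed.

Lemma weight_shift k s : weight (shift k s) = weight s.
Proof. by rewrite /weight config_shift ?expGp // det_mulmx det_expG mulr1. Qed.

(** Weighted signed count of the labelings whose simplex on [y] and the [a l *m GF ^+ s l] has the
    origin in its interior. *)
Definition degree (y : 'rV[F]_n) (a : 'I_n -> 'rV[F]_n) : int :=
  \sum_s weight s * simplex_sign (cons_row y (config GF a s)).

(* Moving one orbit of vertices sweeps a union of free orbits of simplices over the origin. *)
Lemma degree_step (y : 'rV[F]_n) (a a' : 'I_n -> 'rV[F]_n) (t : 'I_n) :
  (forall l, l != t -> a' l = a l) ->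
  (forall s, weight s != 0 ->
    general_position (cons_row y (cons_row (a' t *m GF ^+ s t) (config GF a s)))) ->
  (p%:Z %| (degree y a' - degree y a)%R)%Z.
Proof.
move=> aa gp.
(* Deleting row 0 leaves shift-invariant terms ([S0]), deleting the new vertex gives minus the old
   degree ([S1]), deleting the old vertex at [t] gives the new degree ([S2]). The terms deleting
   another vertex [l] ignore the label of [l] and cancel. *)
pose M (s : {ffun 'I_n -> 'I_p}) := cons_row y (cons_row (a' t *m GF ^+ s t) (config GF a s)).
have GFp : GF ^+ p = 1 by rewrite -map_expG expGp map_mx1.
have : \sum_s weight s * \sum_i face_sign (M s) i = 0.
  apply: big1 => s _; have [->|w0] := eqVneq (weight s) 0; first by rewrite mul0r.
  by rewrite sum_face_sign ?mulr0 //; apply: gp.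
under eq_bigr => s _ do rewrite mulr_sumr.
rewrite exchange_big /= !big_ord_recl (bigD1 t) //= [X in _ + (_ + (_ + X))]big1 ?addr0 => [|l lt]; last first.
  apply: (@sum_weight_indep (fun s => face_sign (M s) (lift 0 (lift 0 l))) l) => s j; rewrite !face_signE; congr (_ * simplex_sign _).
  apply: (@row'_eq F n.+2 n (M (set_at s l j)) (M s)) => i; have [i' ->|->] := unliftP 0 i; last by rewrite !row_cons_row0.
  rewrite !row_cons_rowS (inj_eq lift_inj).
  have [i'' ->|->] := unliftP 0 i'; last first.
    by rewrite !row_cons_row0 ffunE [t == l]eq_sym (negbTE lt).
  by rewrite (inj_eq lift_inj) !row_cons_rowS !rowK ffunE => /negbTE ->.
set S0 := \sum_s weight s * face_sign _ _; set S1 := \sum_s weight s * face_sign _ _.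
set S2 := \sum_s weight s * face_sign _ _.
have -> : S1 = - degree y a.
  rewrite -sumrN; apply: eq_bigr => s _; rewrite -mulrN face_signE row'1_cons_row.
  by rewrite expr1 mulN1r.
have -> : S2 = degree y a'.
  apply: eq_bigr => s _; congr (_ * _).
  (* Exchanging rows [i1] and [i2] puts the new vertex in the place of the old one; the sign of the
     exchange cancels that of deleting row 1. *)
  set i1 : 'I_n.+2 := lift 0 0; set i2 : 'I_n.+2 := lift 0 (lift 0 t).
  have i12 : i1 != i2 by [].
  have -> : i2 = tperm i1 i2 i1 by rewrite tpermL.
  rewrite -[LHS]opprK -face_sign_xrow // face_signE expr1 mulN1r opprK; congr simplex_sign.
  rewrite -(row'1_cons_row y 0 (config GF a' s)).
  apply: (@row'_eq F n.+2 n (xrow i1 i2 (M s)) (cons_row y (cons_row 0 _))) => i ii1; apply/rowP => c; rewrite ![row _ _ _ _]mxE.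
  rewrite /xrow mxE; have [->|ii2] := eqVneq i i2.
    by rewrite tpermR !cons_rowS cons_row0 !mxE.
  rewrite tpermD 1?eq_sym //; move: ii1 ii2; have [i' ->|->] := unliftP 0 i; last by rewrite !cons_row0.
  rewrite !cons_rowS !(inj_eq lift_inj); have [i'' ->|->//] := unliftP 0 i'.
  by rewrite (inj_eq lift_inj) !cons_rowS => _ it; rewrite !mxE aa.
move=> E; have -> : degree y a' - degree y a = - S0 by rewrite -[RHS]addr0 -E; ring.
(* Without [y], a shift multiplies every row by [GF ^+ k], which has determinant 1. *)
rewrite rpredN; apply: (@dvd_sum_shift _ t) => s k; rewrite weight_shift; congr (_ * _).
rewrite !face_signE !row'0_cons_row config_shift //.
rewrite [in LHS](_ : a' t *m _ = a' t *m GF ^+ s t *m GF ^+ k); last first.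
  by have /row_matrixP/(_ t) := @config_shift _ GF a' s k GFp; rewrite row_mul !rowK.
rewrite -cons_row_mulmx simplex_sign_mulmx //.
by rewrite -map_expG det_map_mx det_expG ltr01.
Qed.

Local Notation bF := (fun l => map_mx intr (b l) : 'rV[F]_n).

Definition bpool : seq 'rV[F]_n :=
  [seq bF l *m GF ^+ (j : 'I_p) | l <- enum 'I_n, j <- enum 'I_p].

Definition mix (a : 'I_n -> 'rV[F]_n) (t : nat) (l : 'I_n) : 'rV[F]_n :=
  if (l < t)%N then a l else bF l.

Lemma config_map s : config GF bF s = map_mx intr (config G b s).
Proof.
by apply/row_matrixP => l; rewrite rowK -map_row rowK map_mxM map_expG.
Qed.

(** In a dependence missing two rows the coefficients vanish in turn: that of [a t], those of [a l]
    for [l] decreasing below [t], that of [y]. What remains is a dependence of the rows of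
    [config GF bF s], excluded by the nonzero weight. *)
Lemma general_position_mix (y : 'rV[F]_n) (a : 'I_n -> 'rV[F]_n) (t : 'I_n) s :
  generic p GF y bpool ->
  (forall l, generic p GF (a l) ((y :: bpool) ++ earlier p GF a l)) ->
  weight s != 0 ->
  general_position (cons_row y (cons_row (a t *m GF ^+ s t) (config GF (mix a t) s))).
Proof.
move=> geny gena w0 i j c ij ci cj cM.
pose i1 : 'I_n.+2 := lift 0 0; pose ll (l : 'I_n) : 'I_n.+2 := lift 0 (lift 0 l).
set M := cons_row _ _ in cM *.
have M0 : row 0 M = y by rewrite row_cons_row0.
have M1 : row i1 M = a t *m GF ^+ s t by rewrite row_cons_rowS row_cons_row0.
have Mll l : row (ll l) M = mix a t l *m GF ^+ s l by rewrite !row_cons_rowS rowK.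
have cases k : [\/ k = 0, k = i1 | exists l, k = ll l].
  have [k' ->|->] := unliftP 0 k; last by constructor 1.
  by have [k'' ->|->] := unliftP 0 k'; [constructor 3; exists k''|constructor 2].
have bin l k : bF l *m GF ^+ (k : 'I_p) \in bpool.
  by apply/allpairsP; exists (l, k); rewrite !mem_enum.
have ain (l l' : 'I_n) k : (l < l')%N -> a l *m GF ^+ (k : 'I_p) \in earlier p GF a l'.
  by move=> lt; apply/allpairsP; exists (l, k); rewrite !mem_enum.
have c1 : c 0 i1 = 0.
  apply: (generic_coef0 (leqnn _) (gena t) M1 _ ij ci cj cM) => k kne _.
  case: (cases k) kne => [->|->|[l ->]] //; first by rewrite M0 mem_head.
  move=> _; rewrite Mll /mix mem_cat; case: ifP => lt; first by rewrite ain ?orbT.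
  by rewrite inE bin orbT.
have cl (l : 'I_n) : (l < t)%N -> c 0 (ll l) = 0.
  have [k] := ubnP (t - l); elim: k l => // k IH l tlk lt.
  have Ml : row (ll l) M = a l *m GF ^+ s l by rewrite Mll /mix lt.
  apply: (generic_coef0 (leqnn _) (gena l) Ml _ ij ci cj cM) => k' kne.
  case: (cases k') kne => [->|->|[l' ->]]; first by rewrite M0 mem_head.
    by rewrite c1 eqxx.
  rewrite Mll /mix mem_cat; case: ifP => l't; last by rewrite inE bin orbT.
  case: (ltngtP l l') => [ll'|ll'|/val_inj ->]; last by rewrite eqxx.
    by rewrite IH ?eqxx //; move: tlk; lia.
  by rewrite ain ?orbT.
have c0 : c 0 0 = 0.
  have M0' : row 0 M = y *m GF ^+ (ord0 : 'I_p) by rewrite M0 expr0 mulmx1.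
  apply: (generic_coef0 (leqnn _) geny M0' _ ij ci cj cM) => k kne.
  case: (cases k) kne => [->|->|[l ->]]; rewrite ?eqxx ?c1 ?eqxx // => _.
  by rewrite Mll /mix; case: ifP => [/cl ->|_]; rewrite ?eqxx ?bin.
pose u := \row_l c 0 (ll l).
have u0 : u = 0.
  apply/eqP; apply: contraNT w0 => u0.
  have : \det (config GF bF s) == 0.
    apply/det0P; exists u => //; rewrite -[RHS]cM !mulmx_sum_row !big_ord_recl.
    rewrite c0 -/i1 c1 !scale0r !add0r; apply: eq_bigr => l _.
    rewrite -/(ll l) Mll !rowK mxE /mix; case: ifP => // /cl ->.
    by rewrite !scale0r.
  by rewrite config_map det_map_mx intr_eq0.
apply/rowP => k; rewrite [RHS]mxE; case: (cases k) => [->|->|[l ->]] //.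
by have /rowP/(_ l) := u0; rewrite !mxE.
Qed.

Lemma eq_degree y a a' : a =1 a' -> degree y a = degree y a'.
Proof.
move=> aa; apply: eq_bigr => s _; congr (_ * simplex_sign (cons_row _ _)).
by apply/row_matrixP => l; rewrite !rowK aa.
Qed.

Lemma degree_generic (y : 'rV[F]_n) (a : 'I_n -> 'rV[F]_n) :
  generic p GF y bpool ->
  (forall l, generic p GF (a l) ((y :: bpool) ++ earlier p GF a l)) ->
  (p%:Z %| (degree y a - degree y bF)%R)%Z.
Proof.
move=> geny gena.
(* The single moves through the hybrids [mix a k] telescope. *)
have step k : (k <= n)%N -> (p%:Z %| (degree y (mix a k) - degree y bF)%R)%Z.
  elim: k => [|k IH] kn.
    by rewrite (@eq_degree _ (mix a 0) bF) // subrr dvdz0.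
  have := @degree_step y (mix a k) (mix a k.+1) (Ordinal kn).
  rewrite -[degree y (mix a k.+1) - degree y bF](subrKA (degree y (mix a k))) => H.
  apply: rpredD (IH (ltnW kn)); apply: H => [l lk|s w0].
    rewrite /mix ltnS leq_eqVlt orb_idl // => /eqP E.
    by move: lk; rewrite -(inj_eq val_inj) /= E eqxx.
  have -> : mix a k.+1 (Ordinal kn) = a (Ordinal kn) by rewrite /mix ltnSn.
  exact: general_position_mix.
have := step n (leqnn n); rewrite (@eq_degree _ (mix a n) a) // => l.
by rewrite /mix ltn_ord.
Qed.

(** A generic perturbation keeps the finitely many separating inequalities, so every weighted term
    and hence the degree is zero. The constraints [hs] keep the perturbed [y] where the degree of
    [bF] is known not to be divisible by [p]. *)
Lemma not_separated (y : 'rV[F]_n) (a : 'I_n -> 'rV[F]_n) (hs : seq 'cV[F]_n) :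
  (forall h, h \in hs -> 0 < (y *m h) 0 0) ->
  (forall y', (forall h, h \in hs -> 0 < (y' *m h) 0 0) -> ~~ (p%:Z %| degree y' bF)%Z) ->
  (forall s, weight s != 0 -> exists h : 'cV[F]_n,
     0 < (y *m h) 0 0 /\ forall l, 0 < (a l *m GF ^+ s l *m h) 0 0) -> False.
Proof.
move=> ypos ndvd sep.
have uG : GF \in unitmx by rewrite unitmxE det_map_mx detG unitr1.
have [s|H Hs] := @fin_all_exists _ _ (fun s (h : 'cV[F]_n) => weight s != 0 ->
     0 < (y *m h) 0 0 /\ forall l, 0 < (a l *m GF ^+ s l *m h) 0 0).
  by have [_|/sep[h hP]] := eqVneq (weight s) 0; [exists 0|exists h].
pose ws := [seq s <- enum {ffun 'I_n -> 'I_p} | weight s != 0].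
have [h|y' y'pos y'gen] := exists_generic p uG bpool (hs := hs ++ [seq H s | s <- ws]) (x := y).
  rewrite mem_cat => /orP[/ypos//|/mapP[s]]; rewrite mem_filter => /andP[ws0 _] ->.
  by have [] := Hs s ws0.
have [l h|a' a'pos a'gen] := exists_generic_family p uG (y' :: bpool)
    (hs := fun l => [seq GF ^+ s l *m H s | s : {ffun 'I_n -> 'I_p} <- ws]) (a := a).
  move=> /mapP[s]; rewrite mem_filter => /andP[ws0 _] ->.
  by rewrite mulmxA; have [] := Hs s ws0.
have : degree y' a' = 0.
  apply: big1 => s _; have [->|ws0] := eqVneq (weight s) 0; first by rewrite mul0r.
  have sws : s \in ws by rewrite mem_filter ws0 mem_enum.
  rewrite (@simplex_sign_eq0 _ _ _ (H s)) ?mulr0 // => k.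
  have [l ->|->] := unliftP 0 k; last first.
    by rewrite row_cons_row0 y'pos // mem_cat map_f ?orbT.
  rewrite row_cons_rowS rowK -mulmxA; apply: a'pos.
  exact: (map_f (fun s : {ffun 'I_n -> 'I_p} => GF ^+ s l *m H s)).
move=> d0; have := degree_generic y'gen a'gen; rewrite d0 sub0r rpredN.
apply/negP; apply: ndvd => h hh; apply: y'pos.
by rewrite mem_cat hh.
Qed.

End Degree.

(** * Sarkaria's tensor trick and the cyclic action *)

Section Tensor.
Variables (m q : nat).
Local Notation p := q.+1.
Local Notation N := (m * q)%N.

(* The vertices of a simplex in dimension [q] centered at the origin, the last one being indexed by [q]. *)
Definition wvec (j : nat) : 'rV[int]_q := \row_k ((k == j :> nat)%:R - (j == q)%:R).

(** The cyclic rotation of the simplex: row [k] is the image of the basis vector [wvec k]. *)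
Definition wrot : 'M[int]_q := \matrix_k wvec k.+1.

Lemma wvec_lt j (jq : (j < q)%N) : wvec j = delta_mx 0 (Ordinal jq).
Proof. by apply/rowP => k; rewrite !mxE [in RHS]/= (ltn_eqF jq) subr0. Qed.

Lemma wvec_rot j : (j <= q)%N -> wvec j = wvec 0 *m wrot ^+ j.
Proof.
elim: j => [_|j IH jq]; first by rewrite expr0 mulmx1.
by rewrite exprSr mulmxA -IH 1?ltnW // (wvec_lt jq) -rowE rowK.
Qed.

Lemma sum_wvec : \sum_(j < p) wvec j = 0.
Proof.
apply/rowP => k; rewrite summxE mxE; under eq_bigr => j _ do rewrite mxE.
rewrite sumrB (bigD1 (widen_ord (leqnSn q) k)) //= eqxx big1 => [|j].
  rewrite (bigD1 ord_max) //= eqxx big1 ?addr0 ?subrr // => j.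
  by rewrite -(inj_eq val_inj) /= => /negbTE ->.
by rewrite -(inj_eq val_inj) /= eq_sym => /negbTE ->.
Qed.

(** The sum kills [wvec 0] and commutes with [wrot], hence kills the basis [wvec 0 *m wrot ^+ k]. *)
Lemma sum_wrot : \sum_(j < p) wrot ^+ j = 0.
Proof.
set S := \sum_(j < p) _.
have w0S : wvec 0 *m S = 0.
  rewrite -[RHS]sum_wvec mulmx_sumr; apply: eq_bigr => j _.
  by rewrite -wvec_rot // -ltnS.
apply/row_matrixP => k; rewrite row0 rowE.
have -> : delta_mx 0 k = wvec 0 *m wrot ^+ k.
  by rewrite -wvec_rot 1?ltnW // (wvec_lt (ltn_ord k)); congr delta_mx; apply: val_inj.
have -> : wvec 0 *m wrot ^+ k *m S = wvec 0 *m (wrot ^+ k * S) by rewrite mulmxA.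
have -> : wrot ^+ k * S = S * wrot ^+ k.
  rewrite mulr_sumr mulr_suml; apply: eq_bigr => j _.
  by rewrite -!exprD addnC.
by rewrite mulmxA w0S mul0mx.
Qed.

Definition Grot : 'M[int]_N := lin_mx (mulmxr wrot).

Lemma mxvec_Grot (A : 'M[int]_(m, q)) j : mxvec A *m Grot ^+ j = mxvec (A *m wrot ^+ j).
Proof.
elim: j => [|j IH]; first by rewrite !expr0 !mulmx1.
by rewrite !exprSr !mulmxA IH mul_vec_lin.
Qed.

Lemma sum_Grot : \sum_(j < p) Grot ^+ j = 0.
Proof.
apply/row_matrixP => i; rewrite row0 rowE -[delta_mx _ _]vec_mxK mulmx_sumr.
under eq_bigr => j _ do rewrite mxvec_Grot.
by rewrite -linear_sum /= -mulmx_sumr sum_wrot mulmx0 linear0.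
Qed.

(** [Grot ^+ p] is the identity, and for odd [p] only the integer 1 has [p]-th power 1. The cyclic
    group thus preserves orientation. *)
Lemma det_Grot : odd p -> \det Grot = 1.
Proof.
move=> op; have : Grot ^+ p = 1 by apply: expGp sum_Grot.
have detX k : \det (Grot ^+ k) = \det Grot ^+ k.
  by elim: k => [|k IH]; rewrite ?expr0 ?det1 // !exprS det_mulmx IH.
move=> /(congr1 (fun A => \det A)); rewrite detX det1 => E.
have g0 : 0 < \det Grot by rewrite -(exprn_odd_gt0 _ op) E.
by move/eqP: E; rewrite pexpr_eq1 // ?ltW // => /eqP.
Qed.

Definition unidx (l : 'I_N) : 'I_m * 'I_q := enum_val (cast_ord (esym (mxvec_cast m q)) l).

Lemma unidxK l : mxvec_index (unidx l).1 (unidx l).2 = l.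
Proof. by rewrite /mxvec_index -surjective_pairing enum_valK cast_ordKV. Qed.

Lemma mxvec_indexK i k : unidx (mxvec_index i k) = (i, k).
Proof. by rewrite /unidx cast_ordK enum_rankK. Qed.

(** All [q] points of color class [i] go to the unit vector [i] tensored with [wvec 0]. *)
Definition bvec (l : 'I_N) : 'rV[int]_N :=
  mxvec (delta_mx (unidx l).1 0 *m wvec 0 : 'M[int]_(m, q)).

Lemma config_bvecE (s : {ffun 'I_N -> 'I_p}) l c :
  config Grot bvec s l c =
  ((unidx c).1 == (unidx l).1)%:R * (((unidx c).2 == s l :> nat)%:R - (s l == q :> nat)%:R).
Proof.
rewrite mxE mxvec_Grot -mulmxA -wvec_rot -1?ltnS // -{1}(unidxK c) mxvecE mxE big_ord1 !mxE.
by rewrite andbT.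
Qed.

Local Notation wt := (weight Grot bvec).

Lemma weight_inj (s : {ffun 'I_N -> 'I_p}) l l' : wt s != 0 ->
  (unidx l).1 = (unidx l').1 -> s l = s l' -> l = l'.
Proof.
move=> w0 ll sl; apply/eqP; apply: contraNT w0 => ne; apply/eqP.
apply: (determinant_alternate ne) => c.
by rewrite !config_bvecE ll sl.
Qed.

Definition colorful (s : {ffun 'I_N -> 'I_p}) := [forall l, (s l < q)%N] &&
  [forall l, forall l', ((unidx l).1 == (unidx l').1) && (s l == s l') ==> (l == l')].

(** * Computation of the degree at the special configuration *)

Section Count.
Variables (F : realFieldType) (y : 'rV[F]_N).
Hypothesis yneg : forall c, y 0 c < 0.
Local Notation GF := (map_mx intr Grot : 'M[F]_N).
Local Notation bF := (fun l => map_mx intr (bvec l) : 'rV[F]_N).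
Local Notation sgn s := (simplex_sign (cons_row y (config GF bF s))).

Lemma all_sign_neq0 (T : finType) (e : T -> F) : all_sign e != 0 ->
  exists x, forall k, 0 < x * e k.
Proof.
rewrite /all_sign; case: forallP => [H _|_]; first by exists 1 => k; rewrite mul1r.
case: forallP => [H _|//]; exists (-1) => k.
by rewrite mulN1r oppr_gt0.
Qed.

Lemma cons_row_dependence (s : {ffun 'I_N -> 'I_p}) c :
  bdet1 (cons_row y (config GF bF s)) 0 * y 0 c +
  \sum_l bdet1 (cons_row y (config GF bF s)) (lift 0 l) * (config Grot bvec s l c)%:~R = 0.
Proof.
have /rowP/(_ c) := bdet1_dependence (cons_row y (config GF bF s)).
rewrite summxE big_ord_recl [RHS]mxE => E; rewrite -[RHS]E; congr (_ + _).
  by rewrite !mxE unlift_none.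
apply: eq_bigr => l _; rewrite [RHS]mxE row_cons_rowS; congr (_ * _).
by rewrite config_map !mxE.
Qed.

(** A class using the label [q] misses some label [j < q], having only [q] points. In the coordinate
    given by the class and [j] all rows are nonpositive and [y] is negative, so no dependence has
    all coefficients of one strict sign. *)
Lemma simplex_sign_lt (s : {ffun 'I_N -> 'I_p}) l : sgn s != 0 -> (s l < q)%N.
Proof.
move=> /all_sign_neq0[x xpos]; have := ltn_ord (s l); rewrite ltnS leq_eqVlt => /orP[/eqP sl|//].
have /existsP[j /forallP jP] : [exists j : 'I_q, forall k, s (mxvec_index (unidx l).1 k) != j :> nat].
  apply: contraT; rewrite negb_exists => /forallP H.
  pose f k := s (mxvec_index (unidx l).1 k).
  have : (#|'I_p| <= #|codom f|)%N.
    apply/subset_leq_card/subsetP => i _; have := ltn_ord i; rewrite ltnS leq_eqVlt => /orP[/eqP iq|iq].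
      apply/codomP; exists (unidx l).2; rewrite /f unidxK; apply: val_inj.
      by rewrite /= iq sl.
    have := H (Ordinal iq); rewrite negb_forall => /existsP[k]; rewrite negbK => /eqP fk.
    by apply/codomP; exists k; apply: val_inj.
  by rewrite card_ord => /leq_trans/(_ (leq_image_card _ _)); rewrite card_ord ltnn.
have := cons_row_dependence s (mxvec_index (unidx l).1 j).
move/(congr1 (fun z => x * z)); rewrite mulr0 mulrDr => /eqP; rewrite lt_eqF //.
rewrite mulrA ltr_nwDl //; first by rewrite pmulr_rlt0.
rewrite mulr_sumr; apply: sumr_le0 => l' _; rewrite mulrA pmulr_rle0 //.
rewrite config_bvecE mxvec_indexK /=; case: eqP => [E|_]; last by rewrite mul0r.
have := jP (unidx l').2; rewrite E unidxK eq_sym => /negbTE ->.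
by rewrite mul1r sub0r; case: (_ == _); rewrite ?rmorphN ?rmorph1 ?rmorph0 ?lerN10 ?oppr0.
Qed.

(** The configuration is a permutation matrix with determinant [wt s], which is 1 or -1; as [y] is
    negative, all coefficients of the dependence have this sign. *)
Lemma colorful_term (s : {ffun 'I_N -> 'I_p}) : colorful s -> wt s * sgn s = 1.
Proof.
case/andP => /forallP lt /forallP inj.
pose phi l := mxvec_index (unidx l).1 (Ordinal (lt l)).
have AE l c : config Grot bvec s l c = (c == phi l)%:R.
  rewrite config_bvecE (ltn_eqF (lt l)) subr0 -natrM mulnb.
  congr ((nat_of_bool _)%:R); apply/andP/eqP => [[/eqP E1 /eqP E2]|->].
    by rewrite -(unidxK c) /phi E1; congr mxvec_index; apply: val_inj.
  by rewrite mxvec_indexK /= !eqxx.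
have phi_inj : injective phi.
  move=> l l' E; apply/eqP; have /forallP/(_ l')/implyP := inj l; apply.
  have := congr1 unidx E; rewrite !mxvec_indexK => -[-> E2]; rewrite eqxx /=.
  by rewrite -(inj_eq val_inj) /= E2.
have w2 : wt s * wt s = 1.
  rewrite /weight -[X in _ * X]det_tr -det_mulmx -[RHS](det1 _ N); congr (\det _).
  apply/matrixP => l l'; rewrite mxE (bigD1 (phi l)) //= big1 => [|c cl].
    by rewrite [_^T _ _]mxE !AE eqxx mul1r addr0 (inj_eq phi_inj) mxE.
  by rewrite AE (negbTE cl) mul0r.
pose B k := bdet1 (cons_row y (config GF bF s)) k.
have B0 : B 0 = (wt s)%:~R.
  by rewrite /B bdet1_cons_row config_map det_map_mx.
have Bl l : B (lift 0 l) = - y 0 (phi l) * B 0.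
  have := cons_row_dependence s (phi l); rewrite (bigD1 l) //= big1 ?addr0 => [|l' l'l].
    by rewrite AE eqxx mulr1 -/(B 0) -/(B _) => E; apply/eqP; rewrite -subr_eq0 -E; apply/eqP; ring.
  by rewrite AE eq_sym (inj_eq phi_inj) (negbTE l'l) mulr0.
have pos k : exists2 e, 0 < e & B k = e * B 0.
  have [l ->|->] := unliftP 0 k; last by exists 1; rewrite ?mul1r.
  by exists (- y 0 (phi l)); rewrite ?oppr_gt0.
have [w1|w1] : wt s = 1 \/ wt s = -1.
  have : (wt s - 1) * (wt s + 1) = 0 by rewrite -[RHS](subrr 1) -{3}w2; ring.
  by move/eqP; rewrite mulf_eq0 subr_eq0 addr_eq0 => /orP[]/eqP; [left|right].
- have -> : sgn s = 1.
    rewrite /simplex_sign /all_sign; case: forallP => [_|[]]; last first.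
      by move=> k; rewrite -/(B k); have [e e0 ->] := pos k; rewrite B0 w1 mulr1.
    case: forallP => // /(_ 0); rewrite -/(B 0) B0 w1.
    by rewrite ltr10.
  by rewrite w1.
have -> : sgn s = -1.
  rewrite /simplex_sign /all_sign; case: forallP => [/(_ 0)|_].
    by rewrite -/(B 0) B0 w1 rmorphN rmorph1 ltr0N1.
  case: forallP => [//|[]] k; rewrite -/(B k); have [e e0 ->] := pos k.
  by rewrite B0 w1 rmorphN rmorph1 mulrN1 oppr_lt0.
by rewrite w1.
Qed.

Lemma card_colorful : #|colorful| = (q`! ^ m)%N.
Proof.
pose inj := [set f : {ffun 'I_q -> 'I_q} | injectiveb f].
pose psi (f : {ffun 'I_m -> {ffun 'I_q -> 'I_q}}) : {ffun 'I_N -> 'I_p} :=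
  [ffun l => widen_ord (leqnSn q) (f (unidx l).1 (unidx l).2)].
have psi_inj : injective psi.
  move=> f g /ffunP fg; apply/ffunP => i; apply/ffunP => k.
  have := fg (mxvec_index i k); rewrite !ffunE mxvec_indexK /= => /(congr1 val) /= E.
  exact: val_inj.
have -> : (q`! ^ m = #|ffun_on inj : pred {ffun 'I_m -> {ffun 'I_q -> 'I_q}}|)%N.
  by rewrite card_ffun_on card_inj_ffuns !card_ord ffactnn.
rewrite -(card_imset _ psi_inj); apply: eq_card => s.
apply/idP/imsetP => [/andP[/forallP lt /forallP sinj]|[f /ffun_onP fon ->]].
  exists [ffun i => [ffun k => Ordinal (lt (mxvec_index i k))]].
    apply/ffun_onP => i; rewrite inE; apply/injectiveP => k k'; rewrite !ffunE => -[E].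
    have /forallP/(_ (mxvec_index i k')) := sinj (mxvec_index i k).
    rewrite !mxvec_indexK eqxx /= -(inj_eq val_inj) /= E eqxx /= => /eqP /(congr1 unidx).
    by rewrite !mxvec_indexK => -[].
  apply/ffunP => l; apply: val_inj; rewrite !ffunE /=.
  by rewrite unidxK.
apply/andP; split; first by apply/forallP => l; rewrite ffunE /=.
apply/forallP => l; apply/forallP => l'; apply/implyP => /andP[/eqP E].
rewrite -(inj_eq val_inj) !ffunE /= E (inj_eq val_inj) => /eqP.
have := fon (unidx l').1; rewrite inE => /injectiveP /[apply] E2.
by apply/eqP; rewrite -(unidxK l) -(unidxK l') E E2.
Qed.

Lemma degree_bvec : degree q Grot bvec y bF = (q`! ^ m)%:Z.
Proof.
rewrite -card_colorful -natz -sumr_const big_mkcond; apply: eq_bigr => s _.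
case: ifP => [/colorful_term//|/negbT]; rewrite /in_mem /=.
have [->|w0] := eqVneq (wt s) 0; first by rewrite mul0r.
have [->|s0] := eqVneq (sgn s) 0; first by rewrite mulr0.
case/negP; apply/andP; split; first by apply/forallP => l; apply: simplex_sign_lt.
apply/forallP => l; apply/forallP => l'; apply/implyP => /andP[/eqP E /eqP E'].
by apply/eqP; apply: weight_inj w0 E E'.
Qed.

End Count.

End Tensor.

Lemma fin_all_or_exists (T : finType) (P Q : T -> Prop) :
  (forall x, P x \/ Q x) -> (forall x, P x) \/ exists x, Q x.
Proof.
move=> PQ; suff [H|] : (forall x, x \in enum T -> P x) \/ exists x, Q x.
- by left=> x; apply: H; rewrite mem_enum.
- by right.
elim: (enum T) => [|x s [IH|]]; [by left| |by right].
have [Px|Qx] := PQ x; last by right; exists x.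
by left=> z; rewrite inE => /predU1P[->|/IH].
Qed.

(** By Wilson's theorem the factorial of [q] is -1 modulo [q.+1]. *)
Lemma prime_ndvd_factX q m : prime q.+1 -> ~~ (q.+1 %| q`! ^ m)%N.
Proof.
move=> pr; rewrite Euclid_dvdX // negb_and; apply/orP; left.
apply/negP => dv; have := Wilson (prime_gt1 pr); rewrite pr /= => /esym.
by rewrite -(addn1 q`!) dvdn_addr // dvdn1 => /eqP E; move: pr; rewrite E.
Qed.

(** * From the degree to a nonnegative dependence of tensors *)

Section Decoding.
Variables (F : realFieldType) (m q : nat).
Local Notation p := q.+1.
Local Notation N := (m * q)%N.
Local Notation GF := (map_mx intr (Grot m q) : 'M[F]_N).
Local Notation wF j := (map_mx intr (wvec q j) : 'rV[F]_q).

Lemma mxvec_GF (A : 'M[F]_(m, q)) j :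
  mxvec A *m GF ^+ j = mxvec (A *m (map_mx intr (wrot q) : 'M[F]_q) ^+ j).
Proof.
have -> : GF = lin_mx (mulmxr (map_mx intr (wrot q))).
  by apply: map_lin_mx => B; rewrite /= map_mxM.
elim: j => [|j IH]; first by rewrite !expr0 !mulmx1.
by rewrite !exprSr !mulmxA IH mul_vec_lin.
Qed.

Lemma tensor_GF (X : 'cV[F]_m) (j : 'I_p) :
  mxvec (X *m wF 0) *m GF ^+ j = mxvec (X *m wF j).
Proof.
rewrite mxvec_GF -mulmxA; congr (mxvec (_ *m _)).
rewrite [in RHS]wvec_rot -1?ltnS // map_mxM; congr (_ *m _).
by elim: (j : nat) => [|k IH]; rewrite ?expr0 ?map_mx1 // !exprS map_mxM IH.
Qed.

(** By [not_separated] some labeling of nonzero weight is not separated from the origin, and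
    Gordan's alternative gives its dependence. Nonzero weight yields injectivity on color classes;
    [y], constant -1, becomes the right-hand side [c0]. *)
Lemma tensor_dependence (X : 'I_N -> 'cV[F]_m) : prime p -> odd p ->
  exists (s : {ffun 'I_N -> 'I_p}) (c0 : F) (c : 'I_N -> F),
  [/\ forall l l', (unidx l).1 = (unidx l').1 -> s l = s l' -> l = l',
      0 <= c0, forall l, 0 <= c l, 0 < c0 \/ exists l, 0 < c l &
      forall i (j : 'I_q), \sum_l c l * (X l i 0 * ((j == s l :> nat)%:R - (s l == q :> nat)%:R)) = c0].
Proof.
move=> pr op.
pose y : 'rV[F]_N := const_mx (-1).
pose a l := mxvec (X l *m wF 0).
pose v (s : {ffun 'I_N -> 'I_p}) := y :: [seq a l *m GF ^+ s l | l <- enum 'I_N].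
pose wt (s : {ffun 'I_N -> 'I_p}) := weight (Grot m q) (@bvec m q) s.
have [s|sep|[s [w0 [c [c0 [k ck] cs]]]]] := @fin_all_or_exists _
  (fun s => wt s != 0 -> exists h : 'cV[F]_N, forall u, u \in v s -> 0 < (u *m h) 0 0)
  (fun s => wt s != 0 /\ exists c : 'I_(size (v s)) -> F, [/\ forall i, 0 <= c i, exists i, 0 < c i &
     \sum_i c i *: (v s)`_i = 0]).
- have [w0|w0] := eqVneq (wt s) 0; first by left.
  by have [|] := gordan (v s); [left|right].
(* The constraints keep all coordinates of the perturbed [y] negative, as [degree_bvec] requires. *)
- exfalso; apply: (@not_separated F N q (Grot m q) (det_Grot m op) (sum_Grot m q) (@bvec m q) y a
    [seq - delta_mx c 0 | c <- enum 'I_N]).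
  + move=> h /mapP[c _ ->]; rewrite mulmxN mxE -colE !mxE.
    by rewrite opprK ltr01.
  + move=> y' yneg; rewrite degree_bvec ?dvdzE //; first exact: prime_ndvd_factX.
    move=> c; have := yneg _ (map_f (fun c => - delta_mx c 0) (mem_enum 'I_N c)).
    by rewrite mulmxN mxE -colE mxE oppr_gt0.
  + move=> s /sep[h hP]; exists h; split; first by apply: hP; rewrite mem_head.
    by move=> l; apply: hP; rewrite inE; apply/orP; right; apply/mapP; exists l; rewrite ?mem_enum.
have sz : size (v s) = N.+1 by rewrite /= size_map size_enum_ord.
pose c' i := c (cast_ord (esym sz) i).
exists s, (c' 0), (fun l => c' (lift 0 l)); split.
- by move=> l l'; apply: weight_inj.
- exact: c0.
- by move=> l; apply: c0.
- have kE : c' (cast_ord sz k) = c k by rewrite /c' cast_ordK.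
  have [l lE|lE] := unliftP 0 (cast_ord sz k); last by left; rewrite -lE kE.
  by right; exists l; rewrite -lE kE.
move=> i j.
have vE (l : 'I_N) : (v s)`_(l.+1) = a l *m GF ^+ s l.
  by rewrite /= (nth_map l) ?size_enum_ord // nth_ord_enum.
have E : c' 0 *: y + \sum_l c' (lift 0 l) *: mxvec (X l *m wF (s l)) = 0.
  rewrite -[RHS]cs (reindex (cast_ord (esym sz))) /=; last first.
    by exists (cast_ord sz) => z _; rewrite ?cast_ordK ?cast_ordKV.
  rewrite [RHS]big_ord_recl; congr (_ + _); apply: eq_bigr => l _; congr (_ *: _).
  by rewrite -tensor_GF; apply: etrans (esym (vE l)) _.
have /rowP/(_ (mxvec_index i j)) := E; rewrite mxE [in X in X + _]mxE mxE summxE mxE.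
move=> /eqP; rewrite mulrN1 addrC subr_eq0 => /eqP <-; apply: eq_bigr => l _.
rewrite mxE mxvecE mxE big_ord1 !mxE rmorphB /= !rmorph_nat.
by [].
Qed.

End Decoding.

(** Points are lifted by a coordinate 1. In each coordinate, the weighted sums over the labels below
    [q] all exceed that over the label [q] by [c0], so they agree; dividing by their common mass
    gives the point. *)
Lemma colored_tverberg_prime (F : realFieldType) (d q : nat)
    (x : 'I_d.+1 * 'I_q -> 'I_d -> F) : prime q.+1 -> odd q.+1 ->
  exists (s : 'I_d.+1 * 'I_q -> 'I_q.+1) (c : 'I_d.+1 * 'I_q -> F) (pt : 'I_d -> F),
  [/\ forall i k k', s (i, k) = s (i, k') -> k = k', forall z, 0 <= c z &
      forall j : 'I_q, \sum_(z | s z == j :> nat) c z = 1 /\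
        forall e, \sum_(z | s z == j :> nat) c z * x z e = pt e].
Proof.
move=> pr op.
pose X l : 'cV[F]_d.+1 := \col_i if unlift 0 i is Some e then x (unidx l) e else 1.
have [s [c0 [c [sinj c00 cge cpos rel]]]] := tensor_dependence X pr op.
pose T (j : nat) i := \sum_(l | s l == j :> nat) c l * X l i 0.
have q0 : (0 < q)%N by case: (q) pr.
pose j0 : 'I_q := Ordinal q0.
have TE (j : 'I_q) i : T j i = T q i + c0.
  rewrite -(rel i j) /T [X in X = _]big_mkcond [X in _ = X + _]big_mkcond -big_split /=.
  apply: eq_bigr => l _; rewrite [(j : nat) == _]eq_sym.
  by case: (_ == _); case: (_ == _); rewrite /=; ring.
have TJ (j : 'I_q) i : T j i = T j0 i by rewrite !TE.
have T1 j : T j 0 = \sum_(l | s l == j :> nat) c l.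
  by apply: eq_bigr => l _; rewrite mxE unlift_none mulr1.
have Tge j : 0 <= T j 0 by rewrite T1 sumr_ge0.
set mu := T j0 0.
(* If the common mass were zero, [c0] and the mass of the label [q] would vanish too, and with them
   all coefficients, against [cpos]. *)
have mu0 : 0 < mu.
  rewrite lt_def Tge andbT; apply/eqP => mu0.
  have /eqP : T q 0 + c0 = 0 by rewrite -(TE j0).
  rewrite paddr_eq0 // => /andP[/eqP Tq /eqP c0E].
  case: cpos => [|[l cl]]; first by rewrite c0E ltxx.
  have Tl : T (s l) 0 = 0.
    have := ltn_ord (s l); rewrite ltnS leq_eqVlt => /orP[/eqP->//|lq].
    by rewrite -mu0; apply: (TJ (Ordinal lq)).
  move: Tl; rewrite T1 => /psumr_eq0P H.
  by move: cl; rewrite H ?eqxx ?ltxx.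
pose idx (z : 'I_d.+1 * 'I_q) := mxvec_index z.1 z.2.
have sumE (j : nat) (f : 'I_d.+1 * 'I_q -> F) :
    \sum_(z | s (idx z) == j :> nat) f z = \sum_(l | s l == j :> nat) f (unidx l).
  rewrite [RHS](reindex idx) /=; last first.
    by exists (@unidx _ _) => [z|l] _; [rewrite mxvec_indexK; case: z|rewrite /idx unidxK].
  by apply: eq_bigr => -[i k] _; rewrite mxvec_indexK.
exists (fun z => s (idx z)), (fun z => c (idx z) / mu), (fun e => T j0 (lift 0 e) / mu); split.
- move=> i k k' E; have := sinj (idx (i, k)) (idx (i, k')).
  rewrite !mxvec_indexK => /(_ erefl E) /(congr1 (@unidx _ _)).
  by rewrite !mxvec_indexK => -[].
- by move=> z; rewrite divr_ge0 // ltW.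
move=> j; split=> [|e]; rewrite sumE.
  under eq_bigr => l _ do rewrite /idx unidxK.
  by rewrite -mulr_suml -T1 TJ divff // gt_eqF.
rewrite -(TJ j) /T mulr_suml; apply: eq_bigr => l _.
by rewrite /idx unidxK mxE liftK mulrAC.
Qed.

(** * Reduction of the general case to a prime *)

Lemma odd_prime_above r : exists q, [/\ prime q.+1, odd q.+1 & r <= q]%N.
Proof.
have [p rp pr] := prime_above (maxn r 2).
exists p.-1; rewrite prednK ?prime_gt0 //; split=> //; last by move: rp; lia.
by have [p2|//] := even_prime pr; move: rp; rewrite p2; lia.
Qed.

Local Close Scope ring_scope.

Theorem theorem1 :
  forall d r : nat, 1 <= d -> 2 <= r ->
  exists t : nat, 0 < t /\
    forall p : 'I_d.+1 * 'I_t -> point d,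
      injective p ->
      exists Rs : 'I_r -> {set 'I_d.+1 * 'I_t},
        (forall i, rainbow (Rs i)) /\
        (forall i1 i2, i1 != i2 -> [disjoint Rs i1 & Rs i2]) /\
        exists x : point d, forall i, in_conv p (Rs i) x.
Proof.
move=> d r _ r2; have [q [pr op rq]] := odd_prime_above r.
(* Color classes have size [q]; of the [q] label classes with a common point the first [r] are
   kept. *)
exists q; split; first by apply: leq_trans rq; apply: ltnW.
move=> p _; have [s [c [pt [sinj c0 cP]]]] := @colored_tverberg_prime R d q p pr op.
exists (fun i => [set z | s z == i :> nat]); split; last split.
- move=> i j; apply/card_le1_eqP => k k'; rewrite !inE => /eqP E /eqP E'.
  by apply: (sinj j); apply: val_inj; rewrite /= E E'.
- move=> i1 i2 i12; rewrite -setI_eq0; apply/eqP/setP => z; rewrite !inE.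
  by apply/negP => /andP[/eqP -> /eqP /val_inj E]; rewrite E eqxx in i12.
exists pt => i; have [c1 cx] := cP (widen_ord rq i).
exists (fun z => if s z == i :> nat then c z else 0%R); split; last split; last split.
- by move=> z; apply/RleP; case: ifP.
- by move=> z; rewrite inE => /negbTE ->.
- by rewrite -[RHS]c1 [RHS]big_mkcond.
move=> e; rewrite -(cx e) [LHS]big_mkcond; apply: eq_bigr => z _.
by case: ifP => // _; rewrite RmultE mul0r.
Qed.
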